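(* The following conditions are equivalent for an associative ring $R$ with identity: (a) $Spec(R)$ is a normal space. (b) The frame $SP(R)$ is normal.
   Context: Rings are associative with identity, not necessarily commutative; ''ideal'' means two-sided ideal. $Spec(R)$ is the set of prime ideals of $R$ (proper ideals $P$ such that $IJ\subseteq P$ for ideals $I,J$ implies $I\subseteq P$ or $J\subseteq P$) with the hull-kernel topology, whose closed sets are $\{P\in Spec(R)\mid I\subseteq P\}$ for ideals $I$. $SP(R)$ is the set consisting of $R$ together with all semiprime ideals of $R$ (proper ideals $N$ such that $L^2\subseteq N$ implies $L\subseteq N$ for every ideal $L$), ordered by inclusion; it is a frame in which the meet is intersection. A frame is normal if for all $a,b$ with $a\vee b=1$ there exist $a',b'$ with $a\vee b'=1=a'\vee b$ and $a'\wedge b'=0$ (joins, $0$ and $1$ taken in the frame). A topological space is normal if any two disjoint closed subsets are contained respectively in disjoint open subsets (no $T_1$ assumption). *)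

(* Defs.v *)
From HB Require Import structures.
From mathcomp Require Import all_boot all_order all_algebra.
From mathcomp Require Import boolp classical_sets topology.

Set Implicit Arguments.
Unset Strict Implicit.
Unset Printing Implicit Defensive.

Import Order.TTheory GRing.Theory.
Local Open Scope classical_set_scope.
Local Open Scope ring_scope.

Section Ideals.
Variable R : pzRingType.
Implicit Types I J K L N P : set R.

Record is_ideal I : Prop := IsIdeal {
  ideal0 : I 0;
  idealD : forall x y, I x -> I y -> I (x + y);
  idealMl : forall r x, I x -> I (r * x);
  idealMr : forall r x, I x -> I (x * r)
}.

Definition ideal_mul I J : set R :=
  [set z | exists2 s : seq (R * R),
     {in s, forall p, I p.1 /\ J p.2} & z = \sum_(p <- s) p.1 * p.2].

Definition prime_ideal P : Prop :=
  [/\ is_ideal P, P <> setT &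
      forall I J, is_ideal I -> is_ideal J -> ideal_mul I J `<=` P ->
        I `<=` P \/ J `<=` P].

Definition semiprime_ideal N : Prop :=
  [/\ is_ideal N, N <> setT &
      forall L, is_ideal L -> ideal_mul L L `<=` N -> L `<=` N].

Lemma idealT : is_ideal setT.
Proof. by []. Qed.

Lemma ideal_mem_mul I J x y : I x -> J y -> ideal_mul I J (x * y).
Proof.
move=> Ix Jy; exists [:: (x, y)]; last by rewrite big_seq1.
by move=> p; rewrite inE => /eqP ->.
Qed.

Lemma ideal_sum (T : eqType) I (s : seq T) (f : T -> R) :
  is_ideal I -> {in s, forall t, I (f t)} -> I (\sum_(t <- s) f t).
Proof.
move=> idI sI; rewrite big_seq; apply: (big_ind I) => //.
- exact: ideal0.
- exact: idealD.
Qed.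

Lemma ideal_mul_sub I J P : is_ideal P ->
  (ideal_mul I J `<=` P) <-> (forall x y, I x -> J y -> P (x * y)).
Proof.
move=> idP; split=> [sP x y Ix Jy|PM z [s sIJ ->]].
  exact/sP/ideal_mem_mul.
by apply: ideal_sum => // p /sIJ[Ip Jp]; exact: PM.
Qed.

Lemma ideal_mulP I J : is_ideal I -> is_ideal J -> is_ideal (ideal_mul I J).
Proof.
move=> idI idJ; split.
- by exists [::]; rewrite ?big_nil.
- move=> _ _ [s sP ->] [t tP ->]; exists (s ++ t); last by rewrite big_cat.
  by move=> p; rewrite mem_cat => /orP[/sP|/tP].
- move=> r _ [s sP ->]; exists [seq (r * p.1, p.2) | p <- s].
    by move=> _ /mapP[p /sP[Ip Jp] ->]; split=> //=; exact: idealMl.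
  by rewrite big_map mulr_sumr; apply: eq_bigr => p _; rewrite mulrA.
- move=> r _ [s sP ->]; exists [seq (p.1, p.2 * r) | p <- s].
    by move=> _ /mapP[p /sP[Ip Jp] ->]; split=> //=; exact: idealMr.
  by rewrite big_map mulr_suml; apply: eq_bigr => p _; rewrite mulrA.
Qed.

Lemma ideal_mulSl I J : is_ideal I -> ideal_mul I J `<=` I.
Proof. by move=> idI; apply/ideal_mul_sub => // x y Ix _; exact: idealMr. Qed.

Lemma ideal_mulSr I J : is_ideal J -> ideal_mul I J `<=` J.
Proof. by move=> idJ; apply/ideal_mul_sub => // x y _ Jy; exact: idealMl. Qed.

Lemma ideal_bigcap (F : set (set R)) :
  (forall I, F I -> is_ideal I) -> is_ideal (\bigcap_(I in F) I).
Proof.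
move=> idF; split.
- by move=> I /idF/ideal0.
- by move=> x y xF yF I FI; apply: (idealD (idF _ FI)); [exact: xF|exact: yF].
- by move=> r x xF I FI; apply: (idealMl (idF _ FI)); exact: xF.
- by move=> r x xF I FI; apply: (idealMr (idF _ FI)); exact: xF.
Qed.

End Ideals.

Record Spec (R : pzRingType) := MkSpec {
  Spec_ideal :> set R;
  SpecP : prime_ideal Spec_ideal
}.

HB.instance Definition _ (R : pzRingType) := gen_eqMixin (Spec R).
HB.instance Definition _ (R : pzRingType) := gen_choiceMixin (Spec R).

Definition hull (R : pzRingType) (I : set R) : set (Spec R) :=
  [set P : Spec R | I `<=` P].

Section Zariski.
Variable R : pzRingType.

Definition Spec_open (A : set (Spec R)) : Prop :=
  exists2 I : set R, is_ideal I & A = ~` hull I.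

Let Spec_openT : Spec_open setT.
Proof.
exists setT; first exact: idealT.
apply/seteqP; split=> // P _ sTP; have [_ PT _] := SpecP P.
by apply: PT; apply/seteqP; split.
Qed.

Let Spec_openI : setI_closed Spec_open.
Proof.
move=> _ _ [I idI ->] [J idJ ->].
exists (ideal_mul I J); first exact: ideal_mulP.
apply/seteqP; split=> P.
  move=> [nIP nJP] sP; have [_ _ prP] := SpecP P.
  by case: (prP I J idI idJ sP) => [/nIP|/nJP].
move=> nP; split=> sP; apply: nP.
  by move=> z /(ideal_mulSl idI) /sP.
by move=> z /(ideal_mulSr idJ) /sP.
Qed.

Let Spec_open_bigU (T : Type) (f : T -> set (Spec R)) :
  (forall i, Spec_open (f i)) -> Spec_open (\bigcup_i f i).
Proof.
move=> of_; pose K := \bigcap_(J in [set J : set R |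
  is_ideal J /\ forall i I, is_ideal I -> f i = ~` hull I -> I `<=` J]) J.
exists K; first by apply: ideal_bigcap => J [].
apply/seteqP; split=> P.
  move=> [i _]; have [I idI fiE] := of_ i; rewrite fiE => nIP KP; apply: nIP.
  by move=> x Ix; apply: KP => J [_ sJ]; exact: (sJ i I).
move=> nKP; apply: contrapT => nP; apply: nKP => x; apply.
have [idP _ _] := SpecP P; split=> // i I idI fiE.
by apply: contrapT => nIP; apply: nP; exists i => //; rewrite fiE.
Qed.

HB.instance Definition _ :=
  isOpenTopological.Build (Spec R) Spec_openT Spec_openI Spec_open_bigU.

Lemma closed_SpecP (A : set (Spec R)) :
  closed A <-> exists2 I : set R, is_ideal I & A = hull I.
Proof.
rewrite -openC; split=> [[I idI AE]|[I idI ->]]; exists I => //.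
by rewrite -[A]setCK AE setCK.
Qed.

End Zariski.

(* The library states normality through closures of neighborhoods; this is the
   usual separation of disjoint closed sets. *)
Lemma normal_space_disjointP (T : topologicalType) :
  normal_space T <->
  forall A B : set T, closed A -> closed B -> A `&` B = set0 ->
    exists U V : set T, [/\ open U, open V, A `<=` U, B `<=` V
                          & U `&` V = set0].
Proof.
split=> [nT A B clA clB AB0|sepT A clA B].
  have /(nT A clA)[C /set_nbhsP[U [oU AU UC]] clC] : set_nbhs A (~` B).
    apply/set_nbhsP; exists (~` B); split=> //; first exact: closed_openC.
    exact/disjoints_subset.
  exists U, (~` closure C); split=> //.
  - exact/closed_openC/closed_closure.
  - by move=> x Bx /clC; exact.
  - by rewrite -subset0 => x [/UC/subset_closure].
move=> /set_nbhsP[C [oC AC CB]].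
have [||U [V [oU oV AU CV UV0]]] := sepT A (~` C) clA.
- exact: open_closedC.
- by rewrite -subset0 => x [/AC Cx]; exact.
exists U; first by apply/set_nbhsP; exists U; split.
apply: subset_trans CB => x clUx; apply: contrapT => /CV Vx.
have [y [Uy Vy]] := clUx V (open_nbhs_nbhs (conj oV Vx)).
by have : (U `&` V) y by []; rewrite UV0.
Qed.

Local Open Scope order_scope.

HB.mixin Record isFrame (d : Order.disp_t) L of Order.TBLattice d L := {
  bigjoin : set L -> L;
  bigjoin_ub : forall (S : set L) x, S x -> x <= bigjoin S;
  bigjoin_le : forall (S : set L) y, (forall x, S x -> x <= y) ->
    bigjoin S <= y;
  meet_bigjoin : forall (a : L) (S : set L),
    a `&` bigjoin S = bigjoin [set a `&` x | x in S]
}.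

#[short(type="frameType")]
HB.structure Definition Frame (d : Order.disp_t) :=
  { L of Order.TBLattice d L & isFrame d L }.

Definition normal_frame (d : Order.disp_t) (L : frameType d) : Prop :=
  forall a b : L, a `|` b = \top ->
    exists a' b' : L,
      [/\ a `|` b' = \top, a' `|` b = \top & a' `&` b' = \bot].

Record SP (R : pzRingType) := MkSP {
  SP_ideal :> set R;
  SPP : SP_ideal = setT \/ semiprime_ideal SP_ideal
}.

HB.instance Definition _ (R : pzRingType) := gen_eqMixin (SP R).
HB.instance Definition _ (R : pzRingType) := gen_choiceMixin (SP R).

Fact SP_display : Order.disp_t. Proof. exact: Order.Disp tt tt. Qed.

Section SPFrame.
Variable R : pzRingType.
Implicit Types N M : SP R.

Lemma SP_is_ideal N : is_ideal N.
Proof. by case: (SPP N) => [->|[]] //; exact: idealT. Qed.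

Lemma SP_sqr N (L : set R) :
  is_ideal L -> ideal_mul L L `<=` N -> L `<=` N.
Proof. by move=> idL; case: (SPP N) => [->|[_ _ spN]] //; exact: spN. Qed.

Lemma SP_inj N M : N = M :> set R -> N = M.
Proof.
case: N M => [I pI] [J pJ] /= IJ; rewrite -IJ in pJ *.
by rewrite (Prop_irrelevance pI pJ).
Qed.

Lemma SP_of_sqr (I : set R) : is_ideal I ->
  (forall L, is_ideal L -> ideal_mul L L `<=` I -> L `<=` I) ->
  I = setT \/ semiprime_ideal I.
Proof. by move=> idI sqI; have [|nT] := EM (I = setT); [left|right]. Qed.

Definition SP_le N M : bool := `[< SP_ideal N `<=` M >].

Let SP_le_refl : reflexive SP_le.
Proof. by move=> N; apply/asboolP. Qed.

Let SP_le_anti : antisymmetric SP_le.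
Proof.
by move=> N M /andP[/asboolP NM /asboolP MN]; apply/SP_inj/seteqP; split.
Qed.

Let SP_le_trans : transitive SP_le.
Proof.
move=> M N K /asboolP NM /asboolP MK; apply/asboolP.
exact: subset_trans NM MK.
Qed.

HB.instance Definition _ := Order.Le_isPOrder.Build SP_display (SP R)
  SP_le_refl SP_le_anti SP_le_trans.

Lemma SP_leP N M : reflect (SP_ideal N `<=` M) (N <= M).
Proof. exact: asboolP. Qed.

Let SP_infP (F : set (SP R)) : let I := \bigcap_(N in F) SP_ideal N in
  I = setT \/ semiprime_ideal I.
Proof.
apply: SP_of_sqr => [|L idL sL x Lx N FN].
  rewrite -(bigcap_image F (@SP_ideal R) id).
  by apply: ideal_bigcap => _ [N _ <-]; exact: SP_is_ideal.
by apply: SP_sqr Lx => // y /sL; exact.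
Qed.

Definition SP_inf (F : set (SP R)) : SP R := MkSP (SP_infP F).

Let SP_meetP N M :
  let I := (SP_ideal N `&` M)%classic in I = setT \/ semiprime_ideal I.
Proof.
apply: SP_of_sqr => [|L idL sL].
  have [idN idM] := (SP_is_ideal N, SP_is_ideal M); split.
  - by split; exact: ideal0.
  - by move=> x y [Nx Mx] [Ny My]; split; exact: idealD.
  - by move=> r x [Nx Mx]; split; exact: idealMl.
  - by move=> r x [Nx Mx]; split; exact: idealMr.
by rewrite subsetI; split; apply: SP_sqr => // x /sL[].
Qed.

Definition SP_meet N M : SP R := MkSP (SP_meetP N M).

Definition SP_bigjoin (F : set (SP R)) : SP R :=
  SP_inf [set N | forall M, F M -> M <= N].

Definition SP_join N M : SP R := SP_bigjoin [set N; M].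

Definition SP_top : SP R := MkSP (or_introl (erefl [set: R])).

Definition SP_bot : SP R := SP_inf setT.

Let SP_bigjoin_ub (F : set (SP R)) N : F N -> N <= SP_bigjoin F.
Proof.
by move=> FN; apply/SP_leP => x Nx M /(_ _ FN)/SP_leP; exact.
Qed.

Let SP_bigjoin_le (F : set (SP R)) M :
  (forall N, F N -> N <= M) -> SP_bigjoin F <= M.
Proof. by move=> FM; apply/SP_leP => x; exact. Qed.

Let SP_lexI K N M : (K <= SP_meet N M) = (K <= N) && (K <= M).
Proof.
apply/SP_leP/andP => [|[/SP_leP KN /SP_leP KM]]; rewrite subsetI //.
by move=> [KN KM]; split; apply/SP_leP.
Qed.

Let SP_leUx N M K : (SP_join N M <= K) = (N <= K) && (M <= K).
Proof.
apply/idP/andP => [NMK|[NK MK]]; last first.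
  by apply: SP_bigjoin_le => _ [->|->].
by split; apply: le_trans NMK; apply: SP_bigjoin_ub; [left|right].
Qed.

HB.instance Definition _ := Order.POrder_MeetJoin_isLattice.Build
  SP_display (SP R) SP_lexI SP_leUx.

Let SP_le0x N : SP_bot <= N.
Proof. by apply/SP_leP => x; exact. Qed.

Let SP_lex1 N : N <= SP_top.
Proof. exact/SP_leP. Qed.

HB.instance Definition _ := Order.hasBottom.Build SP_display (SP R) SP_le0x.
HB.instance Definition _ := Order.hasTop.Build SP_display (SP R) SP_lex1.

Lemma SP_meetE N M : (N `&` M : SP R) = (SP_ideal N `&` M)%classic :> set R.
Proof. by []. Qed.

Let SP_residualP (A N : SP R) :
  let I := [set x : R | forall a, SP_ideal A a -> SP_ideal N (x * a)%R] in
  I = setT \/ semiprime_ideal I.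
Proof.
move=> I; have [idA idN] := (SP_is_ideal A, SP_is_ideal N).
apply: SP_of_sqr => [|L idL sL x Lx a Aa].
  split.
  - by move=> a _; rewrite mul0r; exact: ideal0.
  - by move=> x y Ix Iy a Aa; rewrite mulrDl; apply: idealD; auto.
  - by move=> r x Ix a Aa; rewrite -mulrA; apply: idealMl; auto.
  - by move=> r x Ix a Aa; rewrite -mulrA; exact/Ix/(idealMl idA).
have idLA : is_ideal (ideal_mul L A) by exact: ideal_mulP.
apply: (SP_sqr idLA); last exact: ideal_mem_mul.
apply/ideal_mul_sub => // y z LAy [s sP ->]; rewrite mulr_sumr.
apply: ideal_sum => // p /sP[Lp Ap]; rewrite mulrA.
by apply: (sL) => //; apply: ideal_mem_mul => //; apply: (ideal_mulSl _ LAy).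
Qed.

Let SP_meet_bigjoin (A : SP R) (F : set (SP R)) :
  A `&` SP_bigjoin F = SP_bigjoin [set A `&` N | N in F].
Proof.
apply/le_anti/andP; split; last first.
  apply: SP_bigjoin_le => _ [N FN <-]; rewrite lexI leIl /=.
  by apply: le_trans (SP_bigjoin_ub FN); exact: leIr.
set N := (X in _ <= X).
apply/SP_leP; apply: SP_sqr; first exact: SP_is_ideal.
apply/ideal_mul_sub => [|x y [_ Fx] [Ay _]]; first exact: SP_is_ideal.
suff /SP_leP : SP_bigjoin F <= MkSP (SP_residualP A N).
  by move=> FN; exact: (FN x Fx y Ay).
apply: SP_bigjoin_le => M FM; apply/SP_leP => z Mz a Aa.
have /SP_leP : A `&` M <= N by apply: SP_bigjoin_ub; exists M.
apply; split; first exact: (idealMl (SP_is_ideal A)).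
exact: (idealMr (SP_is_ideal M)).
Qed.

HB.instance Definition _ := isFrame.Build SP_display (SP R)
  SP_bigjoin_ub SP_bigjoin_le SP_meet_bigjoin.

End SPFrame.

(* Main.v *)
Require Import Defs.
From mathcomp Require Import all_boot all_order all_algebra.
From mathcomp Require Import boolp classical_sets topology.

(** The map sending N to the complement of [hull N] is an isomorphism from
    SP(R) onto the frame of open subsets of Spec(R), and normality of a space
    is normality of its frame of opens.

    The one substantial ingredient is that a semiprime ideal N is an
    intersection of primes ([prime_avoiding]).  For x outside N, semiprimeness
    provides a sequence x = x_0, x_1, ... outside N in which
    x_(n+1) = x_n r_n x_n.  A maximal ideal P among those that contain N and
    avoid the sequence is prime: if I and J are not contained in P, both I + P
    and J + P meet the sequence, hence share some x_n, and then x_(n+1) lies in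
    (I + P)(J + P).  If IJ were contained in P, so would be this product, and P
    would contain a term of the sequence.

    Everything else is a dictionary.  Applied to x = 1, prime avoidance says
    that N \/ M is the whole ring exactly when hull N and hull M are disjoint
    ([SP_join_topP]).  Applied to all x, it says that the bottom of SP(R) is the
    intersection of all primes, so N /\ M is the bottom exactly when the
    complements of hull N and hull M are disjoint ([SP_meet_botP]).  As every
    closed set is the hull of an element of SP(R) ([closed_hullP]), the two
    normality conditions say the same thing. *)

Set Implicit Arguments.
Unset Strict Implicit.
Unset Printing Implicit Defensive.

Import Order.TTheory GRing.Theory.
Import Defs.
Local Open Scope classical_set_scope.
Local Open Scope ring_scope.

(** * Semiprime ideals are intersections of prime ideals *)

Section PrimeAvoidance.
Variable R : pzRingType.
Implicit Types I J P : set R.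

Definition ideal_add I J : set R := [set p.1 + p.2 | p in I `*` J].

Lemma ideal_addP I J : is_ideal I -> is_ideal J -> is_ideal (ideal_add I J).
Proof.
move=> idI idJ; split.
- by exists (0, 0); rewrite ?addr0 //; split; exact: ideal0.
- move=> _ _ [[a b] [/= Ia Jb] <-] [[c d] [/= Ic Jd] <-].
  by exists (a + c, b + d); [split; exact: idealD|rewrite /= addrACA].
- move=> r _ [[a b] [/= Ia Jb] <-].
  by exists (r * a, r * b); [split; exact: idealMl|rewrite /= mulrDr].
- move=> r _ [[a b] [/= Ia Jb] <-].
  by exists (a * r, b * r); [split; exact: idealMr|rewrite /= mulrDl].
Qed.

Lemma ideal_add_subl I J : is_ideal J -> I `<=` ideal_add I J.
Proof.
by move=> idJ x Ix; exists (x, 0); rewrite ?addr0 //; split=> //; exact: ideal0.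
Qed.

Lemma ideal_add_subr I J : is_ideal I -> J `<=` ideal_add I J.
Proof.
by move=> idI x Jx; exists (0, x); rewrite ?add0r //; split=> //; exact: ideal0.
Qed.

Lemma ideal_add_mul I J P x y : is_ideal P -> ideal_mul I J `<=` P ->
  ideal_add I P x -> ideal_add J P y -> P (x * y).
Proof.
move=> idP IJP [[a b] [/= Ia Pb] <-] [[c d] [/= Jc Pd] <-].
rewrite mulrDr mulrDl; apply: idealD => //; last exact: idealMl.
apply: idealD => //; last exact: idealMr.
by apply: IJP; exact: ideal_mem_mul.
Qed.

(** The elements y with yRx contained in N form an ideal A, and the elements z
    with ARz contained in N form an ideal B.  When xRx is contained in N, the
    element x lies in the intersection of A and B, whose square is contained
    in N. *)
Lemma SP_elementwise (N : SP R) x :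
  (forall r, SP_ideal N (x * r * x)) -> SP_ideal N x.
Proof.
move=> NxRx; have idN := SP_is_ideal N.
pose A := [set y | forall r, SP_ideal N (y * r * x)].
pose B := [set z | forall y r, A y -> SP_ideal N (y * r * z)].
have idL : is_ideal (A `&` B).
  split.
  - split=> [r|y r _]; rewrite ?mul0r ?mulr0; exact: ideal0.
  - move=> y z [Ay By] [Az Bz]; split=> [r|w r Aw].
      by rewrite !mulrDl; apply: idealD.
    by rewrite mulrDr; apply: idealD; auto.
  - move=> s y [Ay By]; split=> [r|w r Aw].
      by rewrite -!mulrA; apply: idealMl => //; rewrite mulrA.
    by rewrite mulrA -(mulrA w); exact: By.
  - move=> s y [Ay By]; split=> [r|w r Aw].
      by rewrite -(mulrA y).
    by rewrite mulrA; apply: idealMr => //; exact: By.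
apply: (SP_sqr idL).
  apply/ideal_mul_sub => // y z [Ay _] [_ Bz].
  by rewrite -[y]mulr1; exact: Bz.
by split=> [//|y r Ay]; exact: Ay.
Qed.

(** Each term of the sequence is a multiple of the previous ones, so two ideals
    that meet the sequence share all its terms from some index on. *)
Lemma prime_avoiding (N : SP R) x : ~ SP_ideal N x ->
  exists2 P : Spec R, SP_ideal N `<=` P & ~ Spec_ideal P x.
Proof.
move=> nNx; have idN := SP_is_ideal N.
have [y|f fP] := @choice R R
  (fun y r => ~ SP_ideal N y -> ~ SP_ideal N (y * r * y)).
  have [Ny|nNy] := EM (SP_ideal N y); first by exists 0.
  apply: contrapT => nex; apply/nNy/SP_elementwise => r.
  by apply: contrapT => nNr; apply: nex; exists r.
pose s n := iter n (fun y => y * f y * y) x.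
have nNs n : ~ SP_ideal N (s n) by elim: n => //= n; exact: fP.
have s_up I n m : is_ideal I -> (n <= m)%N -> I (s n) -> I (s m).
  move=> idI /subnK <-; elim: (m - n)%N => //= k IHk /IHk.
  exact: idealMl.
(* The sets A themselves need not be ideals: this lets the union of the empty
   chain belong to [good], because its union with N is N. *)
pose good := [set A : set R |
  is_ideal (A `|` N) /\ forall n, ~ (A `|` SP_ideal N) (s n)].
have [F Fgood Ftot|A [[idP nPs] Pmax]] := @Zorn_bigcup _ good.
  have [->|/set0P[A0 FA0]] := eqVneq F set0.
    by split=> [|n]; rewrite bigcup_set0 set0U.
  have inU A : F A -> A `|` N `<=` \bigcup_(X in F) X `|` N.
    by move=> FA; apply: setSU; exact: bigcup_sup.
  have inF y : (\bigcup_(X in F) X `|` SP_ideal N) y ->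
      exists2 A, F A & (A `|` SP_ideal N) y.
    by move=> [[A FA Ay]|Ny]; [exists A => //; left|exists A0 => //; right].
  split=> [|n /inF[A FA]]; last by case: (Fgood _ FA) => _; exact.
  have idF A : F A -> is_ideal (A `|` N) by case/Fgood.
  split.
  - by apply: (inU _ FA0); apply: ideal0; exact: idF.
  - move=> y z /inF[A FA Ay] /inF[B FB Bz].
    have [AB|BA] := Ftot _ _ FA FB.
      by apply: (inU _ FB); apply: idealD (idF _ FB) _ _ _ _ => //;
        exact: (setSU AB).
    by apply: (inU _ FA); apply: idealD (idF _ FA) _ _ _ _ => //;
      exact: (setSU BA).
  - by move=> r y /inF[A FA Ay]; apply: (inU _ FA); apply: idealMl => //;
      exact: idF.
  - by move=> r y /inF[A FA Ay]; apply: (inU _ FA); apply: idealMr => //;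
      exact: idF.
set P := A `|` N in idP nPs.
have NP : SP_ideal N `<=` P by move=> y; right.
have add_meets I : is_ideal I -> ~ I `<=` P -> exists n, ideal_add I P (s n).
  move=> idI nIP; apply: contrapT => nex.
  have PQ : P `<=` ideal_add I P := ideal_add_subr idI.
  have QE : ideal_add I P `|` N = ideal_add I P.
    by apply/setUidPl/(subset_trans NP).
  apply: (Pmax (ideal_add I P)); last first.
    split; rewrite QE; first exact: ideal_addP.
    by move=> n Qn; apply: nex; exists n.
  split; first by apply: subset_trans PQ => y; left.
  move=> QA; apply: nIP => y /(ideal_add_subl idP)/QA Ay; by left.
suff primeP : prime_ideal P by exists (MkSpec primeP) => //=; exact: (nPs 0%N).
split=> //; first by move=> PT; apply: (nPs 0%N); rewrite PT.
move=> I J idI idJ IJP; apply: contrapT => /not_orP[nIP nJP].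
have [i Ii] := add_meets I idI nIP; have [j Jj] := add_meets J idJ nJP.
have Ik := s_up _ _ _ (ideal_addP idI idP) (leq_maxl i j) Ii.
have Jk := s_up _ _ _ (ideal_addP idJ idP) (leq_maxr i j) Jj.
apply: (nPs (maxn i j).+1); apply: (ideal_add_mul idP IJP) => //.
exact: (idealMr (ideal_addP idI idP)).
Qed.

End PrimeAvoidance.

(** * The dictionary between SP(R) and subsets of Spec(R) *)

Local Open Scope order_scope.

Section Dictionary.
Variable R : pzRingType.
Implicit Types (N M : SP R) (P : Spec R).

Lemma Spec_semiprime P :
  Spec_ideal P = setT \/ semiprime_ideal (Spec_ideal P).
Proof.
right; have [idP PT primeP] := SpecP P; split=> // L idL LL.
by case: (primeP L L idL idL LL).
Qed.

Definition SP_of_Spec P : SP R := MkSP (Spec_semiprime P).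

Definition SP_radical (I : set R) : SP R :=
  SP_inf [set N | (I `<=` SP_ideal N)%classic].

(** Primes are semiprime, so a prime containing I contains its radical. *)
Lemma hull_radical (I : set R) : hull (SP_radical I) = hull I.
Proof.
apply/seteqP; split=> P sP x.
  by move=> Ix; apply: sP => /= N; exact.
by move=> rad_x; exact: (rad_x (SP_of_Spec P)).
Qed.

Lemma closed_hullP (A : set (Spec R)) :
  closed A <-> exists N, A = hull N.
Proof.
rewrite closed_SpecP; split=> [[I idI ->]|[N ->]].
  by exists (SP_radical I); rewrite hull_radical.
by exists (SP_ideal N) => //; exact: SP_is_ideal.
Qed.

Lemma open_hullP (A : set (Spec R)) :
  open A <-> exists N, A = (~` hull N)%classic.
Proof.
rewrite -closedC closed_hullP.
by split=> -[N AE]; exists N; rewrite -?AE ?setCK // AE setCK.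
Qed.

(** A prime containing both N and M contains their join; conversely, a join
    without 1 lies in a prime, which then belongs to both hulls. *)
Lemma SP_join_topP N M :
  N `|` M = \top <-> (hull N `&` hull M = set0)%classic.
Proof.
split=> [NM1|NM0].
  rewrite -subset0 => P [NP MP]; have [_ PT _] := SpecP P; apply: PT.
  have : N `|` M <= SP_of_Spec P.
    by rewrite leUx; apply/andP; split; apply/SP_leP.
  by rewrite NM1 le1x => /eqP/(congr1 (@SP_ideal R)).
have idJ := SP_is_ideal (N `|` M).
have [J1|/prime_avoiding[P JP _]] := EM (SP_ideal (N `|` M) 1%R).
  apply/SP_inj/seteqP; split=> // x _.
  by rewrite -[x]mulr1; exact: (idealMl idJ).
have : (hull N `&` hull M)%classic P.
  by split; apply: subset_trans JP; apply/SP_leP; [exact: leUl|exact: leUr].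
by rewrite NM0.
Qed.

(** A prime containing the intersection of N and M contains their product,
    hence N or M.  So the hulls cover Spec(R) exactly when N /\ M lies in every
    prime, that is, by prime avoidance, when it is the bottom. *)
Lemma SP_meet_botP N M :
  N `&` M = \bot <-> (~` hull N `&` ~` hull M = set0)%classic.
Proof.
split=> [NM0|NM0].
  rewrite -subset0 => P [nNP nMP]; have [_ _ primeP] := SpecP P.
  have [idN idM] := (SP_is_ideal N, SP_is_ideal M).
  have NMP : N `&` M <= SP_of_Spec P by rewrite NM0 le0x.
  have [|//|//] := primeP N M idN idM.
  apply: subset_trans (elimT (SP_leP _ _) NMP); rewrite SP_meetE subsetI.
  by split; [exact: ideal_mulSl|exact: ideal_mulSr].
apply/eqP; rewrite -lex0; apply/SP_leP => x NMx; apply: contrapT.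
move=> /prime_avoiding[P _]; apply.
have : ~ (~` hull N `&` ~` hull M)%classic P by rewrite NM0.
by case: NMx => Nx Mx /not_andP[/contrapT|/contrapT]; exact.
Qed.

End Dictionary.

Theorem corollary3p10 (R : pzRingType) :
  normal_space (Spec R) <-> normal_frame (SP R).
Proof.
rewrite normal_space_disjointP; split=> [nS a b /SP_join_topP ab1|nF A B].
  have clh (N : SP R) : closed (hull N) by apply/closed_hullP; exists N.
  have [U [V [/open_hullP[a' ->] /open_hullP[b' ->] aU bV UV0]]] :=
    nS _ _ (clh a) (clh b) ab1.
  (* The complement of hull a' contains hull a, so it is a' whose join with a
     is the top; hence the exchange of the two. *)
  exists b', a'; split.
  - by apply/SP_join_topP/disjoints_subset.
  - by apply/SP_join_topP; rewrite setIC; apply/disjoints_subset.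
  - by apply/SP_meet_botP; rewrite setIC.
move=> /closed_hullP[a ->] /closed_hullP[b ->] /SP_join_topP ab1.
have [a' [b' [/SP_join_topP ab' /SP_join_topP a'b /SP_meet_botP a'b'0]]] :=
  nF _ _ ab1.
exists (~` hull b')%classic, (~` hull a')%classic; split.
- by apply/open_hullP; exists b'.
- by apply/open_hullP; exists a'.
- exact/disjoints_subset.
- by apply/disjoints_subset; rewrite setIC.
- by rewrite setIC.
Qed.
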